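(* For all integers $N\ge0$ and $j\ge0$, \[\sum_{\substack{\pi\in\mathcal{D}_{\le N}\\ \gamma(\pi)=j}} q^{\mathcal{E}(\pi)} = {N\brack j}_q,\qquad \sum_{\substack{\pi\in\mathcal{P}_{\le N}\\ \gamma(\pi)=j}} q^{\mathcal{E}(\pi)} = \frac{1}{(q;q)_j(q;q)_{N-j}}.\]
   Context: A partition $\pi=(\lambda_1,\lambda_2,\dots)$ is a finite non-increasing sequence of positive integers; the empty sequence is the unique partition of $0$. $\mathcal{P}_{\le N}$ is the set of partitions with all parts $\le N$, $\mathcal{D}_{\le N}$ the set of partitions into distinct parts all $\le N$. $\mathcal{E}(\pi)=\lambda_2+\lambda_4+\cdots$ and $\gamma(\pi)=\lambda_1-\lambda_2+\lambda_3-\lambda_4+\cdots$. $(a;q)_l=\prod_{i=0}^{l-1}(1-aq^i)$ and ${n+m\brack n}_q=\frac{(q;q)_{n+m}}{(q;q)_n(q;q)_m}$ for $n,m\ge0$, $0$ otherwise. Identities of formal power series in $q$. *)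

(* Defs.v *)
From HB Require Import structures.
From mathcomp Require Import all_boot all_order all_algebra.
From mathcomp Require Import boolp.

Set Implicit Arguments.
Unset Strict Implicit.
Unset Printing Implicit Defensive.

Import Order.TTheory GRing.Theory Num.Theory.
Local Open Scope ring_scope.

(* The ring R[[q]] of formal power series.  A record rather than the bare      *)
(* function type nat -> R, so that it does not pick up pointwise operations.   *)

Record fps (R : Type) := FPS { fcoef : nat -> R }.

Lemma fpsP (R : Type) (f g : fps R) : fcoef f =1 fcoef g <-> f = g.
Proof.
split=> [|-> //]; case: f g => f [g] /= fg; congr FPS; exact/funext.
Qed.

HB.instance Definition _ (R : Type) := gen_eqMixin (fps R).
HB.instance Definition _ (R : Type) := gen_choiceMixin (fps R).

Section FpsRing.
Variable R : comNzRingType.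
Implicit Types f g h : fps R.

Definition fps_zero : fps R := FPS (fun=> 0).
Definition fps_opp f := FPS (fun n => - fcoef f n).
Definition fps_add f g := FPS (fun n => fcoef f n + fcoef g n).
Definition fps_one : fps R := FPS (fun n => (n == 0)%:R).
Definition fps_mul f g :=
  FPS (fun n => \sum_(i < n.+1) fcoef f i * fcoef g (n - i)%N).

Fact fps_addA : associative fps_add.
Proof. by move=> f g h; apply/fpsP=> n /=; rewrite addrA. Qed.

Fact fps_addC : commutative fps_add.
Proof. by move=> f g; apply/fpsP=> n /=; rewrite addrC. Qed.

Fact fps_add0 : left_id fps_zero fps_add.
Proof. by move=> f; apply/fpsP=> n /=; rewrite add0r. Qed.

Fact fps_addN : left_inverse fps_zero fps_opp fps_add.
Proof. by move=> f; apply/fpsP=> n /=; rewrite addNr. Qed.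

HB.instance Definition _ :=
  GRing.isZmodule.Build (fps R) fps_addA fps_addC fps_add0 fps_addN.

Fact fps_mul_rev f g n :
  fcoef (fps_mul f g) n = \sum_(i < n.+1) fcoef f (n - i)%N * fcoef g i.
Proof.
rewrite /= (reindex_inj rev_ord_inj) /=.
by apply: eq_bigr => i _; rewrite (sub_ordK i).
Qed.

Fact fps_mulA : associative fps_mul.
Proof.
move=> f g h; apply/fpsP=> n; rewrite [RHS]fps_mul_rev [LHS]/=.
pose c3 j k := fcoef f j * (fcoef g (n - j - k)%N * fcoef h k).
transitivity (\sum_(j < n.+1) \sum_(k < n.+1 | (k <= n - j)%N) c3 j k).
  apply: eq_bigr => /= j _; rewrite -[\sum_(_ < _) _]/(fcoef (fps_mul g h) _).
  rewrite fps_mul_rev big_distrr /=.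
  by rewrite (big_ord_narrow_leq (leq_subr _ _)).
rewrite (exchange_big_dep predT) //=; apply: eq_bigr => k _.
transitivity (\sum_(j < n.+1 | (j <= n - k)%N) c3 j k).
  apply: eq_bigl => j; rewrite -ltnS -(ltnS j) -!subSn ?leq_ord //.
  by rewrite -subn_gt0 -(subn_gt0 j) -!subnDA addnC.
rewrite (big_ord_narrow_leq (leq_subr _ _)) big_distrl /=.
by apply: eq_bigr => j _; rewrite /c3 -!subnDA addnC mulrA.
Qed.

Fact fps_mulC : commutative fps_mul.
Proof.
move=> f g; apply/fpsP=> n; rewrite fps_mul_rev /=.
by apply: eq_bigr => i _; rewrite mulrC.
Qed.

Fact fps_mul1 : left_id fps_one fps_mul.
Proof.
move=> f; apply/fpsP=> n /=; rewrite big_ord_recl /= mul1r subn0.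
by rewrite big1 ?addr0 // => i _; rewrite mul0r.
Qed.

Fact fps_mulDl : left_distributive fps_mul fps_add.
Proof.
move=> f g h; apply/fpsP=> n /=; rewrite -big_split /=.
by apply: eq_bigr => i _; rewrite mulrDl.
Qed.

Fact fps_one_neq0 : fps_one != 0.
Proof. by apply/eqP=> /fpsP/(_ 0%N)/eqP; rewrite /= oner_eq0. Qed.

HB.instance Definition _ := GRing.Zmodule_isComNzRing.Build (fps R)
  fps_mulA fps_mulC fps_mul1 fps_mulDl fps_one_neq0.

Definition fpsX : fps R := FPS (fun n => (n == 1)%:R).

End FpsRing.

Arguments fpsX R : clear implicits.

Section FpsUnit.
Variable R : comUnitRingType.
Implicit Types f g : fps R.

Definition fps_unit : pred (fps R) := fun f => fcoef f 0 \is a GRing.unit.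

(* The first n + 1 coefficients of f^-1, solving f * f^-1 = 1 degree by degree. *)
Fixpoint fps_inv_coefs f n : seq R :=
  if n is m.+1 then
    let s := fps_inv_coefs f m in
    rcons s (- (fcoef f 0)^-1 * \sum_(i < m.+1) fcoef f (m.+1 - i)%N * s`_i)
  else [:: (fcoef f 0)^-1].

Definition fps_inv f : fps R :=
  if fps_unit f then FPS (fun n => (fps_inv_coefs f n)`_n) else f.

Fact size_fps_inv_coefs f n : size (fps_inv_coefs f n) = n.+1.
Proof. by elim: n => //= n IHn; rewrite size_rcons IHn. Qed.

Fact nth_fps_inv_coefs f n i :
  (i <= n)%N -> (fps_inv_coefs f n)`_i = (fps_inv_coefs f i)`_i.
Proof.
elim: n => [|n IHn]; first by rewrite leqn0 => /eqP->.
rewrite leq_eqVlt => /predU1P[-> //|]; rewrite ltnS => le_in.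
by rewrite [LHS]/= nth_rcons size_fps_inv_coefs ltnS le_in IHn.
Qed.

Fact fps_mulV : {in fps_unit, left_inverse 1 fps_inv *%R}.
Proof.
move=> f Uf; rewrite /fps_inv ifT //; apply/fpsP=> -[|n].
  by rewrite [LHS]/= big_ord1 /= mulVr.
rewrite [LHS]/= big_ord_recr /= subnn nth_rcons size_fps_inv_coefs ltnn eqxx.
rewrite mulrAC mulNr mulVr // mulN1r; apply/eqP; rewrite subr_eq0; apply/eqP.
by apply: eq_bigr => i _; rewrite mulrC [in RHS]nth_fps_inv_coefs // leq_ord.
Qed.

Fact fps_unitP f g : g * f = 1 -> fps_unit f.
Proof.
move=> /fpsP/(_ 0%N); rewrite /= big_ord1 subn0 => gf1.
by apply/unitrPr; exists (fcoef g 0); rewrite mulrC.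
Qed.

Fact fps_inv_out : {in [predC fps_unit], fps_inv =1 id}.
Proof.
by move=> f nUf; rewrite /fps_inv ifF //; apply/negbTE.
Qed.

HB.instance Definition _ := GRing.ComNzRing_hasMulInverse.Build (fps R)
  fps_mulV fps_unitP fps_inv_out.

End FpsUnit.

(* The family (F i), i in A, is summable in R[[q]] with sum f: each power of q *)
(* occurs in only finitely many F i, and f is their coefficientwise sum.       *)
Definition fps_has_sum (R : comNzRingType) (I : eqType)
    (A : pred I) (F : I -> fps R) (f : fps R) : Prop :=
  forall k : nat, exists s : seq I,
    [/\ uniq s,
        forall i, (i \in s) = A i && (fcoef (F i) k != 0) &
        fcoef f k = \sum_(i <- s) fcoef (F i) k].

Definition is_partition (p : seq nat) : bool :=
  sorted geq p && all (fun x => 0 < x)%N p.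

Definition partsP (N : nat) (p : seq nat) : bool :=
  is_partition p && all (fun x => x <= N)%N p.

Definition partsD (N : nat) (p : seq nat) : bool :=
  partsP N p && uniq p.

(* lambda_i is nth 0 p (i - 1), so the even-indexed parts sit at odd positions. *)
Definition even_sum (p : seq nat) : nat :=
  (\sum_(i < size p | odd i) nth 0 p i)%N.

Definition alt_sum (p : seq nat) : int :=
  \sum_(i < size p) (-1) ^+ i * (nth 0%N p i)%:Z.

Definition qPoch (R : comNzRingType) (a q : R) (l : nat) : R :=
  \prod_(i < l) (1 - a * q ^+ i).

Definition qbinom (R : comUnitRingType) (q : R) (n k : nat) : R :=
  if (k <= n)%N then qPoch q q n / (qPoch q q k * qPoch q q (n - k)) else 0.

(* 1 / (q;q)_m for m in Z, with the usual convention that it is 0 for m < 0. *)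
Definition inv_qPoch (R : comUnitRingType) (q : R) (m : int) : R :=
  if m is Posz l then (qPoch q q l)^-1 else 0.

Definition qvar : fps int := fpsX int.

(* Main.v *)
Require Import Defs.
From mathcomp Require Import all_boot all_order all_algebra.
From mathcomp Require Import ring zify.

Set Implicit Arguments.
Unset Strict Implicit.
Unset Printing Implicit Defensive.

Import Order.TTheory GRing.Theory Num.Theory.
Local Open Scope ring_scope.

(** Removing a largest part [N] from a partition [p] with [gamma p = j] leaves a
    partition [p'] with [gamma p' = N - j] and [E p = E p' + (N - j)].  Hence the
    generating functions [D N j], [P N j] of the two families satisfy
      [D N j = D (N - 1) j + q^(N - j) * D (N - 1) (N - j)],
      [P N j = P (N - 1) j + q^(N - j) * P N (N - j)].
    The first recurrence is the q-Pascal rule.  The second one determines the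
    coefficients of [P N j] because [q^(N - j)] raises the degree unless
    [j = N], and in that case [P N (N - j) = P N 0] falls under [j < N]. *)

(** * Power series and q-Pochhammer symbols *)

Lemma fcoefXnM (R : comNzRingType) (m : nat) (f : fps R) (k : nat) :
  fcoef (fpsX R ^+ m * f) k = if (m <= k)%N then fcoef f (k - m) else 0.
Proof.
elim: m k => [|m IHm] k; first by rewrite expr0 mul1r subn0.
rewrite exprS -mulrA; move: (_ ^+ m * f) IHm => g IHm.
rewrite [LHS]/=; case: k => [|k].
  by rewrite big_ord1 mul0r.
rewrite big_ord_recl mul0r add0r big_ord_recl [X in _ + X]big1 => [|i _].
  by rewrite addr0 mul1r [(k.+1 - _)%N]subn1 IHm.
by rewrite mul0r.
Qed.

Lemma fcoefXn (R : comNzRingType) (m k : nat) :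
  fcoef (fpsX R ^+ m) k = (m == k)%:R.
Proof.
rewrite -[_ ^+ m]mulr1 fcoefXnM /=; case: leqP => [le_mk|lt_km].
  by rewrite subn_eq0 eqn_leq le_mk.
by rewrite gtn_eqF.
Qed.

Lemma qPochS (R : comNzRingType) (q : R) (n : nat) :
  qPoch q q n.+1 = qPoch q q n * (1 - q ^+ n.+1).
Proof. by rewrite /qPoch big_ord_recr /= exprS. Qed.

(** Each factor [1 - q ^+ n.+1] has constant term 1, hence is invertible. *)
Lemma qPoch_fpsX_unit (R : comUnitRingType) (n : nat) :
  qPoch (fpsX R) (fpsX R) n \is a GRing.unit.
Proof.
elim: n => [|n IHn]; first by rewrite /qPoch big_ord0 unitr1.
rewrite qPochS unitrM IHn -[_ \is a _]/(fcoef 1 0 - fcoef _ 0 \is a GRing.unit).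
by rewrite fcoefXn subr0 unitr1.
Qed.

Section InvPair.
Variables (R : comUnitRingType) (q : R).
Hypothesis qPoch_unit : forall n, qPoch q q n \is a GRing.unit.

(** The closed form behind both identities: the second generating function itself, and the first
    after division by [qPoch q q n]. *)
Definition inv_qPoch_pair (n j : nat) : R :=
  if (j <= n)%N then (qPoch q q j)^-1 * (qPoch q q (n - j))^-1 else 0.

Lemma inv_qPoch_pairE (n j : nat) :
  inv_qPoch q j%:Z * inv_qPoch q (n%:Z - j%:Z) = inv_qPoch_pair n j.
Proof.
rewrite /inv_qPoch_pair; case: leqP => [le_jn|lt_nj]; first by rewrite subzn.
have -> : n%:Z - j%:Z = Negz (j - n.+1) by lia.
by rewrite mulr0.
Qed.

Lemma qbinomE (n j : nat) :
  qbinom q n j = qPoch q q n * inv_qPoch_pair n j.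
Proof.
rewrite /qbinom /inv_qPoch_pair; case: leqP => _; last by rewrite mulr0.
by rewrite invrM // [X in _ * X = _]mulrC.
Qed.

Lemma inv_qPoch_pair_sub (n j : nat) :
  (j <= n)%N -> inv_qPoch_pair n (n - j) = inv_qPoch_pair n j.
Proof. by move=> le_jn; rewrite /inv_qPoch_pair leq_subr le_jn subKn // mulrC. Qed.

Lemma inv_qPochS (n : nat) :
  (qPoch q q n)^-1 = (1 - q ^+ n.+1) * (qPoch q q n.+1)^-1.
Proof.
apply: (mulIr (qPoch_unit n.+1)); rewrite mulrVK // qPochS mulKr //.
Qed.

(** The boundary case [j = n.+1] fits: the left side is 0 by convention, and the factor [1 - q ^+ 0]
    vanishes. *)
Lemma inv_qPoch_pair_pred (n j : nat) : (j <= n.+1)%N ->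
  inv_qPoch_pair n j = (1 - q ^+ (n.+1 - j)) * inv_qPoch_pair n.+1 j.
Proof.
rewrite leq_eqVlt /inv_qPoch_pair => /predU1P[->|].
  by rewrite ltnn subnn expr0 subrr mul0r.
rewrite ltnS => le_jn; rewrite (leqW le_jn) le_jn subSn //.
by rewrite (inv_qPochS (n - j)) mulrCA.
Qed.

Lemma inv_qPoch_pairS (n j : nat) : (j <= n.+1)%N ->
  inv_qPoch_pair n.+1 j =
    inv_qPoch_pair n j + q ^+ (n.+1 - j) * inv_qPoch_pair n.+1 (n.+1 - j).
Proof.
move=> le_jn; rewrite (inv_qPoch_pair_pred le_jn) inv_qPoch_pair_sub //.
by rewrite -mulrDl subrK mul1r.
Qed.

(** The q-Pascal rule, from [1 - q^(n+1) = (1 - q^(n+1-j)) + q^(n+1-j) * (1 - q^j)]. *)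
Lemma qPoch_inv_pairS (n j : nat) : (j <= n.+1)%N ->
  qPoch q q n.+1 * inv_qPoch_pair n.+1 j =
    qPoch q q n * inv_qPoch_pair n j +
    q ^+ (n.+1 - j) * (qPoch q q n * inv_qPoch_pair n (n.+1 - j)).
Proof.
move=> le_jn; rewrite (inv_qPoch_pair_pred le_jn).
rewrite (inv_qPoch_pair_pred (leq_subr j n.+1)).
rewrite inv_qPoch_pair_sub // subKn // qPochS -{1}(subnK le_jn) exprD.
ring.
Qed.

End InvPair.

(** * Removing the largest part *)

Lemma alt_sum_cons (x : nat) (p : seq nat) :
  alt_sum (x :: p) = x%:Z - alt_sum p.
Proof.
rewrite /alt_sum big_ord_recl /= expr0 mul1r -sumrN; congr (_ + _).
by apply: eq_bigr => i _; rewrite exprS mulN1r mulNr.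
Qed.

(** A new head swaps the parity of positions, so the even-indexed parts become the odd-indexed parts
    of [p], whose sum exceeds [even_sum p] by [alt_sum p]. *)
Lemma even_sum_cons (x : nat) (p : seq nat) :
  (even_sum (x :: p))%:Z = (even_sum p)%:Z + alt_sum p.
Proof.
rewrite /even_sum /alt_sum [size (_ :: _)]/= big_mkcond big_ord_recl /= add0n.
rewrite [X in _ = X%:Z + _]big_mkcond -!natz !natr_sum -big_split /=.
apply: eq_bigr => i _; rewrite !natz -signr_odd.
by case: (odd i); rewrite /= ?mulN1r ?subrr ?add0r ?mul1r.
Qed.

Lemma partsP_cons (n x : nat) (p : seq nat) :
  partsP n (x :: p) = (0 < x <= n)%N && partsP x p.
Proof.
rewrite /partsP /is_partition /= (path_sortedE (rev_trans leq_trans)).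
case: (leqP x n) => [le_xn|]; last by rewrite /= !andbF.
case: (boolP (all (fun y => y <= x)%N p)) => [/allP px|]; last by rewrite !andbF.
have -> : all (fun y => y <= n)%N p.
  by apply/allP=> y /px /leq_trans; apply.
by rewrite !andbT /= andbCA.
Qed.

Lemma partsD_cons (n x : nat) (p : seq nat) :
  partsD n (x :: p) = (0 < x <= n)%N && partsD x.-1 p.
Proof.
rewrite /partsD partsP_cons /= -andbA; case: x => [|x] //; congr (_ && _).
rewrite /partsP -!andbA; congr [&& _, _ & _].
rewrite andbA; congr (_ && _).
(* Parts at most [x.+1] with none equal to it are the same as parts at most [x]. *)
apply/andP/allP => [[/allP px xp] y yp|px].
  have := px y yp; rewrite leq_eqVlt => /predU1P[yx|//].
  by rewrite -yx yp in xp.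
split; first by apply/allP=> y /px /leqW.
by apply/negP=> /px; rewrite ltnn.
Qed.

Definition head_and (a : nat) (A : pred (seq nat)) (p : seq nat) : bool :=
  if p is x :: p' then (x == a) && A p' else false.

Lemma partsPS (n : nat) (p : seq nat) :
  partsP n.+1 p = partsP n p || head_and n.+1 (partsP n.+1) p.
Proof.
case: p => [|x p] //; rewrite !partsP_cons /=.
case: eqP => [->|]; first by rewrite ltnn leqnn.
by move=> ne; rewrite orbF; congr (_ && _); lia.
Qed.

Lemma partsDS (n : nat) (p : seq nat) :
  partsD n.+1 p = partsD n p || head_and n.+1 (partsD n) p.
Proof.
case: p => [|x p] //; rewrite !partsD_cons /=.
case: eqP => [->|]; first by rewrite ltnn leqnn.
by move=> ne; rewrite orbF; congr (_ && _); lia.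
Qed.

Lemma partsP_head_andF (n : nat) (A : pred (seq nat)) (p : seq nat) :
  partsP n p -> head_and n.+1 A p = false.
Proof.
case: p => [|x p] //; rewrite partsP_cons /= => /andP[/andP[_ le_xn] _].
by rewrite ltn_eqF.
Qed.

Lemma alt_sum_bounds (n : nat) (p : seq nat) :
  partsP n p -> 0 <= alt_sum p <= n%:Z.
Proof.
elim: p n => [|x p IHp] n; first by rewrite /alt_sum big_ord0.
rewrite partsP_cons alt_sum_cons => /andP[xn /IHp]; lia.
Qed.

Lemma partsP0 (p : seq nat) : partsP 0 p = (p == [::]).
Proof. by case: p => [|x p] //; rewrite partsP_cons leqn0 lt0n andNb. Qed.

(** * Generating functions *)

(** One degree [k] at a time, so that an induction on the degree is possible; the list enumerates
    the partitions counted by that coefficient. *)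
Definition alt_gf_coef (A : pred (seq nat)) (j : nat) (f : fps int) (k : nat) :=
  exists s : seq (seq nat),
    [/\ uniq s,
        forall p, (p \in s) = [&& A p, alt_sum p == j%:Z & even_sum p == k] &
        fcoef f k = (size s)%:R].

Lemma alt_gf_has_sum (A : pred (seq nat)) (j : nat) (f : fps int) :
  (forall k, alt_gf_coef A j f k) ->
  fps_has_sum (fun p => A p && (alt_sum p == j%:Z))
    (fun p => qvar ^+ even_sum p) f.
Proof.
move=> gfA k; have [s [Us sE fE]] := gfA k; exists s; split=> // [p|].
  by rewrite sE andbA fcoefXn; case: (_ == k).
rewrite fE -sum1_size natr_sum; apply: eq_big_seq => p.
by rewrite sE fcoefXn => /and3P[_ _ ->].
Qed.

Lemma alt_gf_coef0 (A : pred (seq nat)) (j k : nat) :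
  (forall p, A p -> alt_sum p != j%:Z) -> alt_gf_coef A j 0 k.
Proof.
move=> Aj; exists [::]; split=> // p; apply/esym/negP => /and3P[/Aj].
by move/negP.
Qed.

Lemma alt_gf_coef_nil (A : pred (seq nat)) (k : nat) :
  (forall p, A p = (p == [::])) -> alt_gf_coef A 0 1 k.
Proof.
move=> AE; exists (nseq (k == 0)%N [::]); split=> [|p|]; first by case: eqP.
  rewrite AE mem_nseq; have [->|_] := eqVneq p [::]; last by rewrite andbF.
  rewrite /alt_sum /even_sum !big_ord0 eqxx (eq_sym 0%N k).
  by case: (k == 0)%N.
by rewrite size_nseq.
Qed.

(** Here [A] holds the partitions without a leading [n], and [B] the tails of the others. For
    [k < n - j] nothing is asked of [B], since the shifted series has no term in degree [k]. *)
Lemma alt_gf_coef_cons (A B C : pred (seq nat)) (n j : nat) (f g : fps int)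
    (k : nat) :
    (j <= n)%N ->
    (forall p, C p = A p || head_and n B p) ->
    (forall p, A p -> head_and n B p = false) ->
    alt_gf_coef A j f k ->
    ((n - j <= k)%N -> alt_gf_coef B (n - j) g (k - (n - j))) ->
  alt_gf_coef C j (f + qvar ^+ (n - j) * g) k.
Proof.
move=> le_jn CE AB [s [Us sE fE]] gfB.
(* The tails left after removing [n]; the degree condition is additive to avoid truncated
   subtraction. *)
have [t [Ut tE gE]] : exists t : seq (seq nat),
    [/\ uniq t,
        forall p, (p \in t) =
          [&& B p, alt_sum p == (n - j)%N%:Z & (even_sum p + (n - j) == k)%N] &
        fcoef (qvar ^+ (n - j) * g) k = (size t)%:R].
  rewrite fcoefXnM; case: leqP => [le_k|lt_k].
    have [t [Ut tE gE]] := gfB le_k; exists t; split=> // p.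
    by rewrite tE; congr [&& _, _ & _]; lia.
  by exists [::]; split=> // p; apply/esym/negP => /and3P[_ _]; lia.
exists (s ++ map (cons n) t); split=> [|p|].
- rewrite cat_uniq Us map_inj_uniq; last by move=> ? ? [].
  rewrite Ut andbT; apply/hasPn => _ /mapP[p + ->]; rewrite tE => /and3P[Bp _ _].
  rewrite /= sE; apply/negP => /andP[/AB].
  by rewrite /= eqxx Bp.
- rewrite mem_cat sE CE andb_orl; congr (_ || _).
  case: p => [|x p]; first by apply/negP => /mapP[].
  rewrite /=; have [->|ne_xn] := eqVneq x n; last first.
    by apply/negP => /mapP[p' _ [xn _]]; rewrite xn eqxx in ne_xn.
  rewrite mem_map; last by move=> ? ? [].
  rewrite tE /=; case: (B p) => //=.
  (* If [alt_sum (n :: p)] is [j], then [alt_sum p] is [n - j], which is also the growth of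
     [even_sum]. *)
  have := even_sum_cons n p; rewrite alt_sum_cons => En; lia.
- by rewrite size_cat size_map natrD -fE -gE.
Qed.

Lemma alt_gf_coef_gt (A : pred (seq nat)) (n j k : nat) :
  (forall p, A p -> partsP n p) -> (n < j)%N -> alt_gf_coef A j 0 k.
Proof.
by move=> An lt_nj; apply: alt_gf_coef0 => p /An/alt_sum_bounds; lia.
Qed.

Lemma partsD_gf (n j k : nat) :
  alt_gf_coef (partsD n) j (qPoch qvar qvar n * inv_qPoch_pair qvar n j) k.
Proof.
have partsDW m p : partsD m p -> partsP m p by case/andP.
elim: n j k => [|n IHn] j k.
  case: j => [|j]; last first.
    by rewrite mulr0; apply: (alt_gf_coef_gt k (@partsDW 0)).
  rewrite /inv_qPoch_pair /qPoch !big_ord0 !invr1 !mulr1.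
  by apply: alt_gf_coef_nil => p; rewrite /partsD partsP0; case: eqP => // ->.
have [le_j|lt_j] := leqP j n.+1; last first.
  rewrite /inv_qPoch_pair leqNgt lt_j mulr0.
  exact: (alt_gf_coef_gt k (@partsDW n.+1)).
rewrite qPoch_inv_pairS //; last exact: qPoch_fpsX_unit.
apply: alt_gf_coef_cons => // p; first exact: partsDS.
by move/partsDW; apply: partsP_head_andF.
Qed.

Lemma partsP_gf (n j k : nat) :
  alt_gf_coef (partsP n) j (inv_qPoch_pair qvar n j) k.
Proof.
elim: n j k => [|n IHn] j k.
  case: j => [|j]; last exact: (@alt_gf_coef_gt _ 0).
  rewrite /inv_qPoch_pair /qPoch !big_ord0 !invr1 mulr1.
  exact/alt_gf_coef_nil/partsP0.
have step i m : (i <= n.+1)%N ->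
    ((n.+1 - i <= m)%N -> alt_gf_coef (partsP n.+1) (n.+1 - i)
      (inv_qPoch_pair qvar n.+1 (n.+1 - i)) (m - (n.+1 - i))) ->
    alt_gf_coef (partsP n.+1) i (inv_qPoch_pair qvar n.+1 i) m.
  move=> le_i gf; rewrite inv_qPoch_pairS //; last exact: qPoch_fpsX_unit.
  by apply: alt_gf_coef_cons gf => // p; [apply: partsPS | apply: partsP_head_andF].
(* The recurrence refers back to the bound [n.+1] itself, so a strong induction on the degree is
   nested inside the one on [n]. *)
elim/ltn_ind: k j => k IHk j.
have lt_gf i : (i < n.+1)%N ->
    alt_gf_coef (partsP n.+1) i (inv_qPoch_pair qvar n.+1 i) k.
  by move=> lt_i; apply: step => [|le_k]; [apply: ltnW | apply: IHk; lia].
have [/lt_gf//|lt_j|->] := ltngtP j n.+1.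
  by rewrite /inv_qPoch_pair leqNgt lt_j; apply: (@alt_gf_coef_gt _ n.+1).
(* For [j = n.+1] the shift is 0 and the degree stays at [k], but the index drops to 0, where
   [lt_gf] applies. *)
by apply: step => // _; rewrite subnn subn0; apply: lt_gf.
Qed.

Theorem theorem5p3 (N j : nat) :
  fps_has_sum (fun p : seq nat => partsD N p && (alt_sum p == j%:Z))
    (fun p => qvar ^+ even_sum p) (qbinom qvar N j)
  /\
  fps_has_sum (fun p : seq nat => partsP N p && (alt_sum p == j%:Z))
    (fun p => qvar ^+ even_sum p)
    (inv_qPoch qvar j%:Z * inv_qPoch qvar (N%:Z - j%:Z)).
Proof.
split.
  rewrite qbinomE; last exact: qPoch_fpsX_unit.
  exact/alt_gf_has_sum/partsD_gf.
by rewrite inv_qPoch_pairE; apply/alt_gf_has_sum/partsP_gf.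
Qed.
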